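(* Let $k_1,\dots,k_l$ be positive integers with $(k_1,\dots,k_l)\ne(1,1,\dots,1)$ and put $k=k_1+\cdots+k_l$. Then \[ \sum_{i=1}^l\sum_{j=0}^{k_i-2}\zeta_q^t(k_i-j,k_{i+1},\dots,k_l,k_1,\dots,k_{i-1},j+1) =(1-t)\sum_{i=1}^l\zeta_q^t(k_i+1,k_{i+1},\dots,k_l,k_1,\dots,k_{i-1}) +t^l\sum_{i=0}^l(k-i)(1-q)^i\binom{l}{i}\zeta_q^t(k-i+1). \]
   Context: Let $q$, $t$ be formal parameters and $[n]=\frac{1-q^n}{1-q}$. For positive integers $k_1,\dots,k_l$ with $k_1\ge 2$ put $\zeta_q(k_1,\dots,k_l)=\sum_{m_1>m_2>\cdots>m_l\ge1}\prod_{a=1}^l \frac{q^{(k_a-1)m_a}}{[m_a]^{k_a}}\in\mathbb{Q}[[q]]$. The weight of an index $(k_1,\dots,k_l)$ is $k_1+\cdots+k_l$ and its depth is $l$. Define $\zeta_q^t(k_1,\dots,k_l)=\sum'_{\mathbf p}(1-q)^{k-\mathrm{wt}(\mathbf p)}\zeta_q(\mathbf p)\,t^{l-\mathrm{dep}(\mathbf p)}\in\mathbb{Q}[[q]][t]$, where $k=k_1+\cdots+k_l$ and $\mathbf p$ runs over all indices of the form $(k_1\ \square\ k_2\ \square\cdots\square\ k_l)$ in which each $\square$ is filled by one of the three symbols '','' (comma), ''$+$'' or ''$-1+$''. In particular $\zeta_q^t(n)=\zeta_q(n)=\sum_{m\ge1}q^{(n-1)m}/[m]^n$. An inner sum $\sum_{j=0}^{k_i-2}$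 is empty when $k_i=1$. *)

(* Defs.v *)
(* Formal power series in q over Q are represented by their
   coefficient functions nat -> rat; elements of Q[[q]][t] by their
   t-coefficient functions nat -> (nat -> rat). *)
From mathcomp Require Import all_boot all_algebra.

Set Implicit Arguments.
Unset Strict Implicit.
Unset Printing Implicit Defensive.
Import GRing.Theory.
Local Open Scope ring_scope.

Definition fps := nat -> rat.
Definition fps0 : fps := fun _ => 0.
Definition fpsC (c : rat) : fps := fun n => if n == 0%N then c else 0.
Definition fps1 : fps := fpsC 1.
Definition fpsX : fps := fun n => if n == 1%N then 1 else 0.
Definition fps_add (f g : fps) : fps := fun n => f n + g n.
Definition fps_opp (f : fps) : fps := fun n => - f n.
Definition fps_sub (f g : fps) : fps := fps_add f (fps_opp g).
Definition fps_mul (f g : fps) : fps :=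
  fun n => \sum_(i < n.+1) f i * g (n - i)%N.
Definition fps_exp (f : fps) (k : nat) : fps := iter k (fps_mul f) fps1.

(** multiplicative inverse of a series with nonzero constant term:
    the first n+1 coefficients, computed by the usual recursion *)
Fixpoint fps_inv_seq (f : fps) (n : nat) : seq rat :=
  match n with
  | 0 => [:: (f 0%N)^-1]
  | n'.+1 =>
      let s := fps_inv_seq f n' in
      rcons s (- (f 0%N)^-1 *
               \sum_(1 <= i < n'.+2) f i * nth 0 s (n'.+1 - i)%N)
  end.
Definition fps_inv (f : fps) : fps := fun n => nth 0 (fps_inv_seq f n) n.

Definition qint (m : nat) : fps :=
  fps_mul (fps_sub fps1 (fps_exp fpsX m)) (fps_inv (fps_sub fps1 fpsX)).

Definition zterm (k m : nat) : fps :=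
  fps_mul (fps_exp fpsX ((k - 1) * m)) (fps_inv (fps_exp (qint m) k)).

Fixpoint zsum (ks : seq nat) (M : nat) : fps :=
  match ks with
  | [::] => fps1
  | k :: ks' => fun n => \sum_(1 <= m < M.+1) fps_mul (zterm k m) (zsum ks' m.-1) n
  end.

(** q-MZV zeta_q(k_1,...,k_l), the q-adic limit of the partial sums.
    For k_1 >= 2 every summand with m_1 > N lies in q^{N+1} Q[[q]], so the
    coefficient of q^N of the limit equals that of the partial sum with M = N. *)
Definition zeta_q (ks : seq nat) : fps := fun N => zsum ks N N.

Inductive box := Comma | Plus | MinusOnePlus.

Fixpoint boxes (n : nat) : seq (seq box) :=
  match n with
  | 0 => [:: [::]]
  | n'.+1 => flatten [seq [:: Comma :: s; Plus :: s; MinusOnePlus :: s] | s <- boxes n']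
  end.

(** the index (a [] k_2 [] ... [] k_l) for a filling cs *)
Fixpoint fill (a : nat) (ks : seq nat) (cs : seq box) : seq nat :=
  match ks, cs with
  | k :: ks', c :: cs' =>
      match c with
      | Comma => a :: fill k ks' cs'
      | Plus => fill (a + k) ks' cs'
      | MinusOnePlus => fill (a + k - 1) ks' cs'
      end
  | _, _ => [:: a]
  end.

(** elements of Q[[q]][t]: tp m = coefficient of t^m *)
Definition tpoly := nat -> fps.

Definition zeta_qt (ks : seq nat) : tpoly :=
  match ks with
  | [::] => fun m => if m == 0%N then fps1 else fps0
  | k1 :: ks' => fun m N =>
      \sum_(cs <- boxes (size ks'))
        let p := fill k1 ks' cs in
        if (size ks - size p)%N == m then
          fps_mul (fps_exp (fps_sub fps1 fpsX) (sumn ks - sumn p)) (zeta_q p) N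
        else 0
  end.

(* Main.v *)
(* Write x_m = q^m/[m] and y_m = 1/[m], so that y_m - x_m = 1 - q. This identity
   merges the symbols "+" and "-1+" of the definition into
     zeta_q^t(k_1,...,k_l)
       = sum_{m_1 >= ... >= m_l >= 1} t^#{a : m_a = m_(a+1)} prod_a f_(k_a)(m_a)
   with f_k(m) = y_m x_m^(k-1). For m > n a geometric sum gives
     sum_{j=0}^{k-2} f_(k-j)(m) f_(j+1)(n)
       = x_(m-n) (f_k(n) - f_k(m)) - x_m f_k(n).
   Let T be the lower triangular matrix with t on the diagonal and 1 below it,
   D_k = diag(f_k(m))_m, E = (x_(m-n))_{m>n} and H = (x_m)_{m>n}. Then the part
   m_1 > m_(l+1) of the left-hand side is a sum over cyclic shifts of traces
     tr(E^T T Q) - tr(T E^T Q) - tr(H^T T Q)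
   with Q = D_(k_i) T D_(k_(i+1)) T ... T D_(k_(i-1)), and the commutator
   E^T T - T E^T telescopes to a tail sum of the x_d.
   The diagonal part m_1 = m_(l+1) gives the single zeta values. *)
Require Import Defs.
From mathcomp Require Import all_boot all_algebra.
From mathcomp Require Import qpoly ring zify.
Import GRing.Theory.
Local Open Scope ring_scope.

Set Implicit Arguments.
Unset Strict Implicit.
Unset Printing Implicit Defensive.

(** * Indices and their fillings *)

Lemma size_le_sumn (s : seq nat) : all (fun k => 0 < k)%N s -> (size s <= sumn s)%N.
Proof. by elim: s => //= k s IH /andP[k0 /IH]; lia. Qed.

Lemma rot_cons (s : seq nat) i : (i < size s)%N ->
  rot i s = nth 0%N s i :: behead (rot i s).
Proof. by move=> si; rewrite /rot (drop_nth 0%N). Qed.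

Lemma size_fill k r cs : (size (fill k r cs) <= (size r).+1)%N.
Proof.
elim: r k cs => [|b r IH] k [|[] cs] //=; first by rewrite ltnS IH.
  exact: leq_trans (IH _ _) (leqnSn _).
exact: leq_trans (IH _ _) (leqnSn _).
Qed.

Lemma sumn_fill k r cs : (sumn (fill k r cs) <= k + sumn r)%N.
Proof.
elim: r k cs => [|b r IH] k [|[] cs] //=.
- by rewrite addn0 leq_addr.
- by rewrite leq_add2l IH.
- by rewrite addnA IH.
- by apply: leq_trans (IH _ _) _; lia.
Qed.

(** Merging with an entry b >= 1 gives k + b or k + b - 1, both at least k, so the leading entry of
    every filling stays at least 2. *)
Lemma fill_head k r cs : (1 < k)%N -> all (fun a => 0 < a)%N r ->
  exists2 a, (1 < a)%N & exists s, fill k r cs = a :: s.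
Proof.
elim: r k cs => [|b r IH] k [|[] cs] //= k1; try by move=> _; exists k => //; eexists.
- by move=> /andP[b0]; apply: IH; lia.
by move=> /andP[b0]; apply: IH; lia.
Qed.

Lemma fill_gt0 k r cs : (0 < k)%N -> all (fun a => 0 < a)%N r ->
  all (fun a => 0 < a)%N (fill k r cs).
Proof.
elim: r k cs => [|b r IH] k [|[] cs] //= k0; rewrite ?k0 // => /andP[b0 r0] /=;
  apply: IH => //; lia.
Qed.

(* Apply the Euler operator [u d/du] to [(u + c)^l u^(k-l)]. *)
Lemma euler_binomial (R : comPzRingType) (u c : R) k l : (0 < l <= k)%N ->
  \sum_(i < l.+1) (k%:R - i%:R) * 'C(l, i)%:R * c ^+ i * u ^+ (k - i)
  = (k - l)%:R * (u + c) ^+ l * u ^+ (k - l)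
    + l%:R * (u + c) ^+ l.-1 * u ^+ (k - l).+1.
Proof.
case: l => // l lk.
have -> : u ^+ (k - l.+1).+1 = u ^+ (k - l.+1) * u by rewrite exprSr.
rewrite !exprDn !mulr_sumr !mulr_suml.
have -> : \sum_(i < l.+1) l.+1%:R * (u ^+ (l.+1.-1 - i) * c ^+ i *+ 'C(l.+1.-1, i))
     * (u ^+ (k - l.+1) * u)
  = \sum_(i < l.+2) (l.+1 - i)%:R * (u ^+ (l.+1 - i) * c ^+ i *+ 'C(l.+1, i))
     * u ^+ (k - l.+1).
  rewrite [RHS]big_ord_recr /= subnn mulr0n !mul0r addr0; apply: eq_bigr => i _.
  rewrite -(mulr_natr _ 'C(l, i)) -(mulr_natr _ 'C(l.+1, i)).
  have -> : (l.+1 - i = (l - i).+1)%N by have := ltn_ord i; lia.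
  have := congr1 (fun m => m%:R : R) (mul_bin_down l.+1 i).
  rewrite /= !natrM subSn; last by rewrite -ltnS.
  rewrite exprSr => binE.
  transitivity (l.+1%:R * 'C(l, i)%:R
    * (u ^+ (l - i) * u * c ^+ i * u ^+ (k - l.+1))); first by ring.
  by rewrite binE; ring.
rewrite -big_split /=; apply: eq_bigr => i _.
have il : (i <= l.+1)%N by rewrite -ltnS.
have ik : (i <= k)%N by apply: leq_trans il _.
have kiE : (k - i = (k - l.+1) + (l.+1 - i))%N by lia.
rewrite kiE exprD -(mulr_natr _ 'C(l.+1, i)) -natrB // kiE.
rewrite natrD; ring.
Qed.

(** * Lower triangular matrices and traces *)

Section Triangular.
Variables (R : comPzRingType) (n : nat).
Implicit Types A B : 'M[R]_n.

Lemma mulmx_trig A B : is_trig_mx A -> is_trig_mx B -> is_trig_mx (A *m B).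
Proof.
move=> /is_trig_mxP tA /is_trig_mxP tB; apply/is_trig_mxP => i j ij.
rewrite mxE big1 // => p _; have [ip|pi] := ltnP i p; first by rewrite tA ?mul0r.
by rewrite tB ?mulr0 // (leq_ltn_trans pi).
Qed.

Lemma mulmx_trig_diag A B i : is_trig_mx A -> is_trig_mx B ->
  (A *m B) i i = A i i * B i i.
Proof.
move=> /is_trig_mxP tA /is_trig_mxP tB; rewrite mxE (bigD1 i) //= big1 ?addr0 //.
move=> p; rewrite neq_ltn => /orP[pi|ip]; first by rewrite tB ?mulr0.
by rewrite tA ?mul0r.
Qed.

Lemma mxtrace_trmx_mul A B : \tr (A^T *m B) = \sum_i \sum_j A i j * B i j.
Proof.
rewrite /mxtrace exchange_big; apply: eq_bigr => j _; rewrite mxE.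
by apply: eq_bigr => i _; rewrite mxE.
Qed.

End Triangular.

(* In the application c = 1 - q, x m = q^m/[m] and y m = 1/[m] modulo q^(N+1). *)
Section CyclicSum.
Variables (R : comPzRingType) (t c : R) (x y : nat -> R) (N n : nat).
Hypothesis y_def : forall m, (0 < m)%N -> y m = x m + c.
Hypothesis x_rel : forall d m, (0 < d)%N -> (0 < m)%N ->
  x d * (x m - x (m + d)%N) = x (m + d)%N * y m.
Hypothesis x_eq0 : forall m, (N < m)%N -> x m = 0.
(* Chains are cut at m <= n; the slack n >= 2N lets the tail sums of x run to their
   last nonzero term. *)
Hypothesis le2Nn : (N + N <= n)%N.
Implicit Types (r s : seq nat) (k : nat).

(* Matrix and vector indices start at 0: the index i stands for m = i + 1. *)
Definition zfac k (i : nat) : R := y i.+1 * x i.+1 ^+ k.-1.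

Lemma zfacS k i : (0 < k)%N -> zfac k.+1 i = x i.+1 * zfac k i.
Proof. by case: k => // k _; rewrite /zfac /= exprS mulrCA. Qed.

Lemma zfac_eq0 k i : (1 < k)%N -> (N <= i)%N -> zfac k i = 0.
Proof.
by case: k => [|[|k]] // _ Ni; rewrite /zfac /= exprS x_eq0 // mul0r mulr0.
Qed.

(** Both sides are y^2 x^(a+k-2), because x + c = y; this merges the symbols [Plus] and
    [MinusOnePlus]. *)
Lemma zfacM a k i : (0 < a)%N -> (0 < k)%N ->
  zfac (a + k) i + c * zfac (a + k - 1) i = zfac a i * zfac k i.
Proof.
case: a k => [|a] [|k] // _ _.
rewrite /zfac !addSn addnS subn1 /= y_def // exprS exprD; ring.
Qed.

(** * Transfer matrices of weakly decreasing chains *)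

Definition zdiag k : 'M[R]_n := diag_mx (\row_i zfac k i).
Definition zstep : 'M[R]_n :=
  \matrix_(i, j) ((i == j)%:R * t + (j < i)%N%:R).
(** For nonempty [r], entry (i, j) sums over chains i >= m_1 >= ... >= m_l = j, each equality
    weighted by t. *)
Definition zchain r : 'M[R]_n :=
  foldr (fun k A => zstep *m zdiag k *m A) 1%:M r.
Definition zstar k r : R := \sum_i \sum_j (zdiag k *m zchain r) i j.

(** [xdiff] and [xlow] are the matrices E and H of the overview; the shift to 0-based indices
    cancels in i - j. *)
Definition xdiff : 'M[R]_n := \matrix_(i, j) ((j < i)%N%:R * x (i - j)).
Definition xlow : 'M[R]_n := \matrix_(i, j) ((j < i)%N%:R * x i.+1).

Lemma zstep_trig : is_trig_mx zstep.
Proof.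
apply/is_trig_mxP => i j ij; rewrite !mxE -val_eqE /= ltn_eqF // ltnNge ltnW //=.
by rewrite mul0r addr0.
Qed.

Lemma zdiag_trig k : is_trig_mx (zdiag k).
Proof. exact/is_diag_mx_is_trig/diag_mx_is_diag. Qed.

Lemma zchain_trig r : is_trig_mx (zchain r).
Proof.
elim: r => [|k r IH] /=; first exact/is_diag_mx_is_trig/scalar_mx_is_diag.
by rewrite !mulmx_trig ?zstep_trig ?zdiag_trig.
Qed.

Lemma zstep_diag i : zstep i i = t.
Proof. by rewrite mxE eqxx ltnn mul1r addr0. Qed.

Lemma zdiag_diag k i : zdiag k i i = zfac k i.
Proof. by rewrite !mxE eqxx. Qed.

Lemma zchain_diag r i : zchain r i i = t ^+ size r * \prod_(k <- r) zfac k i.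
Proof.
elim: r => [|k r IH] /=; first by rewrite mxE eqxx big_nil mulr1.
rewrite !mulmx_trig_diag ?mulmx_trig ?zstep_trig ?zdiag_trig ?zchain_trig //.
rewrite zstep_diag zdiag_diag IH big_cons exprS; ring.
Qed.

Lemma zdiag_mulE k (A : 'M[R]_n) i j : (zdiag k *m A) i j = zfac k i * A i j.
Proof. by rewrite /zdiag mul_diag_mx !mxE. Qed.

Lemma mul_zdiagE k (A : 'M[R]_n) i j : (A *m zdiag k) i j = A i j * zfac k j.
Proof. by rewrite /zdiag mul_mx_diag !mxE. Qed.

Lemma zchain_rcons r k : zchain (rcons r k) = zchain r *m zstep *m zdiag k.
Proof.
by elim: r => [|a r IH] /=; rewrite ?mulmx1 ?mul1mx // IH !mulmxA.
Qed.

(** All indices of a chain ending at j are at least j >= N, so a factor with exponent k >= 2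
    contains some x_m with m > N and vanishes. *)
Lemma zchain_eq0 r (i j : 'I_n) : has (fun k => 1 < k)%N r -> (N <= j)%N ->
  zchain r i j = 0.
Proof.
elim: r i => // k r IH i /= hr Nj; rewrite -mulmxA mxE big1 // => p _.
rewrite zdiag_mulE; have [pj|jp] := ltnP p j.
  by rewrite (is_trig_mxP (zchain_trig r)) // !mulr0.
case/orP: hr => [k1|hr]; last by rewrite IH // !mulr0.
by rewrite zfac_eq0 ?mul0r ?mulr0 // (leq_trans Nj).
Qed.

Lemma zstar_chain_eq0 k r (i j : 'I_n) :
  has (fun k => 1 < k)%N (k :: r) -> (N <= j)%N ->
  (zdiag k *m zchain r) i j = 0.
Proof.
rewrite zdiag_mulE /= => hr Nj; have [ij|ji] := ltnP i j.
  by rewrite (is_trig_mxP (zchain_trig r)) // mulr0.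
case/orP: hr => [k1|hr]; last by rewrite zchain_eq0 // mulr0.
by rewrite zfac_eq0 ?mul0r // (leq_trans Nj).
Qed.

(** * Tail sums and the commutator of E^T with T *)

Lemma sum_x_widen a b b' : (N < b)%N -> (b <= b')%N ->
  \sum_(a <= d < b') x d = \sum_(a <= d < b) x d.
Proof.
move=> Nb bb'; have [ab|ba] := leqP a b.
  rewrite (big_cat_nat ab bb') /= -[RHS]addr0; congr (_ + _).
  rewrite big_nat big1 // => d /andP[bd _].
  by rewrite x_eq0 // (leq_trans Nb).
rewrite [RHS]big_geq ?(ltnW ba) // big_nat big1 // => d /andP[ad _].
by rewrite x_eq0 // (ltn_trans Nb) // (leq_trans ba).
Qed.

Lemma sum_zstep_col (g : nat -> R) (i : 'I_n) :
  \sum_(p < n) g p * zstep p i = t * g i + \sum_(i.+1 <= p < n) g p.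
Proof.
under eq_bigr do rewrite mxE mulrDr.
rewrite big_split /=; congr (_ + _).
  rewrite (bigD1 i) //= eqxx big1 => [|p /negPf->]; last by rewrite mul0r mulr0.
  by rewrite mul1r addr0 mulrC.
rewrite (big_nat_widenl _ 0%N) //= big_mkord [RHS]big_mkcond /=.
by apply: eq_bigr => p _; case: ifP; rewrite ?mulr1 ?mulr0.
Qed.

Lemma sum_zstep_row (g : nat -> R) (j : 'I_n) :
  \sum_(p < n) zstep j p * g p = t * g j + \sum_(0 <= p < j) g p.
Proof.
under eq_bigr do rewrite mxE mulrDl.
rewrite big_split /=; congr (_ + _).
  rewrite (bigD1 j) //= eqxx big1 => [|p]; first by rewrite mul1r addr0.
  by rewrite eq_sym => /negPf->; rewrite !mul0r.
rewrite (big_nat_widen _ _ _ _ _ (ltnW (ltn_ord j))) /= big_mkord [RHS]big_mkcond /=.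
by apply: eq_bigr => p _; case: ifP; rewrite ?mul1r ?mul0r.
Qed.

(** At (j, i) both products with E^T contain t x_(i-j) if j < i. What remains are the sums of x_d
    over d > i - j and over i - j < d <= i, whose difference is the tail d > i. Subtracting H^T T
    removes the tail d > i + 1, and t x_(i+1) if j < i. *)
Lemma commutatorE (i j : 'I_n) : (j <= i)%N -> (j < N)%N ->
  (xdiff^T *m zstep - zstep *m xdiff^T - xlow^T *m zstep) j i
  = x i.+1 * (1 - t + (i == j)%:R * t).
Proof.
move=> ji jN; rewrite 2![(_ + _ : 'M_n) _ _]mxE 2![(- _ : 'M_n) _ _]mxE.
have -> : (zstep *m xdiff^T) j i =
    \sum_(p < n) zstep j p * ((p < i)%N%:R * x (i - p)).
  by rewrite mxE; apply: eq_bigr => p _; rewrite [xdiff^T _ _]mxE [xdiff _ _]mxE.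
have -> : (xlow^T *m zstep) j i =
    \sum_(p < n) ((j < p)%N%:R * x p.+1) * zstep p i.
  by rewrite mxE; apply: eq_bigr => p _; rewrite 2!mxE.
have -> : (xdiff^T *m zstep) j i =
    \sum_(p < n) ((j < p)%N%:R * x (p - j)%N) * zstep p i.
  by rewrite mxE; apply: eq_bigr => p _; rewrite 2!mxE.
rewrite (sum_zstep_col (fun p => (j < p)%N%:R * x (p - j)%N)).
rewrite (sum_zstep_col (fun p => (j < p)%N%:R * x p.+1)).
rewrite (sum_zstep_row (fun p => (p < i)%N%:R * x (i - p)%N)).
set L := n.+1.
have -> : \sum_(i.+1 <= p < n) (j < p)%N%:R * x (p - j)%N =
    \sum_(i.+1 - j <= d < L) x d.
  (* This tail ends at n - j, which exceeds N since j < N and 2N <= n; hence it extends to the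
     common limit L. *)
  rewrite (@sum_x_widen _ (n - j)); try by lia.
  rewrite -{1}(subnK (leq_trans ji (leqnSn i))) big_addn.
  apply: eq_big_nat => d /andP[id _].
  by rewrite addnK (_ : (j < d + j)%N) ?mul1r //; lia.
have -> : \sum_(i.+1 <= p < n) (j < p)%N%:R * x p.+1 = \sum_(i.+2 <= d < L) x d.
  rewrite [RHS]big_add1 /=; apply: eq_big_nat => d /andP[id _].
  by rewrite (leq_ltn_trans ji) ?mul1r.
have -> : \sum_(0 <= p < j) (p < i)%N%:R * x (i - p)%N =
    \sum_(i.+1 - j <= d < i.+1) x d.
  rewrite [RHS]big_nat_rev /= -{1}(add0n (i.+1 - j)%N) big_addn subKn //; last by lia.
  apply: eq_big_nat => d /andP[_ dj]; rewrite (leq_trans dj ji) mul1r; congr x; lia.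
rewrite (@big_cat_nat _ _ _ i.+1 (i.+1 - j) L) /= ?leq_subr //; last first.
  by rewrite /L ltnW // ltnS.
rewrite (@big_ltn _ _ _ i.+1 L); last by rewrite ltnS.
have [->|/negPf ij] := eqVneq i j; first by rewrite ltnn mulr0n mulr1n; ring.
by rewrite ltn_neqAle ji (eq_sym (nat_of_ord j)) (val_eqE i j) ij mulr0n mulr1n; ring.
Qed.

(** * Splitting one entry between the two ends of a chain *)

Lemma sum_zfac_pair k i j : (0 < k)%N -> (j < i)%N ->
  \sum_(a < k.-1) zfac (k - a) i * zfac a.+1 j
  = x (i - j) * (zfac k j - zfac k i) - x i.+1 * zfac k j.
Proof.
case: k => // k _ ji; rewrite /= /zfac /=.
have eqn : (j.+1 + (i - j) = i.+1)%N by lia.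
have := @x_rel (i - j) j.+1; rewrite eqn subn_gt0 => /(_ ji isT) rel.
have yij : y j.+1 = y i.+1 + (x j.+1 - x i.+1) by rewrite !y_def //; ring.
have powB := subrXX (x j.+1) (x i.+1) k.
(* Rewriting x_(i+1) y_(j+1) by [x_rel] turns y_(j+1) into y_(i+1), because y - x is constant. The
   difference of powers is then a geometric sum, and [x_rel] absorbs its linear factor. *)
transitivity (y i.+1 * (x (i - j) * (x j.+1 ^+ k - x i.+1 ^+ k))); last first.
  transitivity (x (i - j) * (y j.+1 * x j.+1 ^+ k - y i.+1 * x i.+1 ^+ k)
     - x (i - j) * (x j.+1 - x i.+1) * x j.+1 ^+ k); first by rewrite yij; ring.
  by rewrite rel; ring.
rewrite powB [x (i - j) * _]mulrA rel -!mulrA !mulr_sumr (reindex_inj rev_ord_inj).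
apply: eq_bigr => a _ /=.
have -> : (k.+1 - (k - a.+1)).-1 = a.+1 by have := ltn_ord a; lia.
have -> : (k.-1 - a = k - a.+1)%N by lia.
by rewrite exprS; ring.
Qed.

Lemma sum_zfac_pair_diag k i : (0 < k)%N ->
  \sum_(a < k.-1) zfac (k - a) i * zfac a.+1 i = k.-1%:R * (y i.+1 * zfac k i).
Proof.
case: k => // k _; rewrite mulr_natl.
have -> : forall z : R, z *+ k = \sum_(a < k) z.
  by move=> z; rewrite sumr_const card_ord.
rewrite /zfac /=.
apply: eq_bigr => a _; have -> : (k.+1 - a).-1 = (k - a)%N by lia.
rewrite -[k in RHS](subnK (ltnW (ltn_ord a))) exprD; ring.
Qed.

Definition zprod r i : R := \prod_(k <- r) zfac k i.

(** The middle of a chain from i to j has weight ([zchain r *m zstep]) i j. Entries with i > j give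
    the three traces, i = j gives the power of t, and i < j vanishes by triangularity. *)
Lemma sum_zstar_pair k r : (0 < k)%N ->
  \sum_(a < k.-1) zstar (k - a) (rcons r a.+1)
  = \tr (xdiff^T *m zchain (rcons r k))
    - \tr (xdiff^T *m (zdiag k *m zchain r *m zstep))
    - \tr (xlow^T *m zchain (rcons r k))
    + t ^+ (size r).+1 * \sum_(i < n) k.-1%:R * (y i.+1 * zprod (k :: r) i).
Proof.
move=> k0; rewrite !mxtrace_trmx_mul -!sumrB.
have -> : t ^+ (size r).+1 * \sum_(i < n) k.-1%:R * (y i.+1 * zprod (k :: r) i)
  = \sum_i \sum_j (i == j)%:R
      * ((zchain r *m zstep) i j * (k.-1%:R * (y i.+1 * zfac k i))).
  rewrite mulr_sumr; apply: eq_bigr => i _.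
  rewrite (bigD1 i) //= big1 ?addr0 => [|j]; last first.
    by rewrite eq_sym => /negPf->; rewrite mul0r.
  rewrite eqxx mulmx_trig_diag ?zchain_trig ?zstep_trig // zchain_diag zstep_diag.
  by rewrite /zprod big_cons exprS mulr1n; ring.
rewrite -big_split /= exchange_big; apply: eq_bigr => i _.
rewrite -!sumrB -big_split /= exchange_big; apply: eq_bigr => j _.
transitivity ((zchain r *m zstep) i j * \sum_(a < k.-1) zfac (k - a) i * zfac a.+1 j).
  rewrite mulr_sumr; apply: eq_bigr => a _.
  by rewrite zdiag_mulE zchain_rcons mul_zdiagE; ring.
rewrite zchain_rcons mul_zdiagE -mulmxA zdiag_mulE.
have [ij|ji|/val_inj ->] := ltngtP i j.
- have /is_trig_mxP -> // := mulmx_trig (zchain_trig r) zstep_trig.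
  by rewrite -val_eqE /= ltn_eqF // mulr0n; ring.
- by rewrite sum_zfac_pair // !mxE ji -val_eqE /= gtn_eqF // mulr0n mulr1n; ring.
by rewrite sum_zfac_pair_diag // !mxE ltnn eqxx mulr0n mulr1n; ring.
Qed.

(** By cyclicity of the trace the left side is tr((E^T T - T E^T - H^T T) Q). Q is lower triangular
    and its columns j >= N vanish, so only entries covered by [commutatorE] contribute. *)
Lemma trace_cyclic k r : (0 < k)%N -> has (fun k => 1 < k)%N (k :: r) ->
  \tr (xdiff^T *m zchain (k :: r))
    - \tr (xdiff^T *m (zdiag k *m zchain r *m zstep))
    - \tr (xlow^T *m zchain (k :: r))
  = (1 - t) * zstar k.+1 r
    + t ^+ (size r).+1 * \sum_(i < n) x i.+1 * zprod (k :: r) i.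
Proof.
move=> k0 hkr; set Q := zdiag k *m zchain r.
have -> : zchain (k :: r) = zstep *m Q by rewrite /= mulmxA.
rewrite (mulmxA _ Q) [\tr (_ *m zstep)]mxtrace_mulC !(mulmxA _ _ Q).
rewrite -!linearB /= -!mulmxBl.
rewrite /zstar !mulr_sumr -big_split /=.
rewrite mxtrace_mulC [LHS]/mxtrace; apply: eq_bigr => i _; rewrite mxE mulr_sumr.
have -> : t ^+ (size r).+1 * (x i.+1 * zprod (k :: r) i)
  = \sum_j (i == j)%:R * t * x i.+1 * Q i j.
  rewrite (bigD1 i) //= big1 ?addr0 => [|j]; last first.
    by rewrite eq_sym => /negPf->; rewrite !mul0r.
  rewrite eqxx mulmx_trig_diag ?zdiag_trig ?zchain_trig // zdiag_diag zchain_diag.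
  by rewrite /zprod big_cons exprS mulr1n; ring.
rewrite -big_split /=; apply: eq_bigr => j _.
have -> : (zdiag k.+1 *m zchain r) i j = x i.+1 * Q i j.
  by rewrite !zdiag_mulE zfacS // mulrA.
have [Nj|jN] := leqP N j; first by rewrite [Q i j]zstar_chain_eq0 //; ring.
have [ij|ji] := ltnP i j; last by rewrite commutatorE //; ring.
rewrite /Q zdiag_mulE (is_trig_mxP (zchain_trig r)) //; ring.
Qed.

(** * Summation over cyclic shifts *)

Lemma zprodE s i : all (fun k => 0 < k)%N s ->
  zprod s i = y i.+1 ^+ size s * x i.+1 ^+ (sumn s - size s).
Proof.
rewrite /zprod; elim: s => [|k s IH] /=; first by rewrite big_nil mulr1.
move=> /andP[k0 s0]; rewrite big_cons IH //.
have -> : (k + sumn s - (size s).+1 = k.-1 + (sumn s - size s))%N.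
  by have := size_le_sumn s0; lia.
rewrite /zfac exprS exprD; ring.
Qed.

Lemma zstar_cyclic s : all (fun k => 0 < k)%N s -> has (fun k => 1 < k)%N s ->
  \sum_(i < size s) \sum_(a < (nth 0%N s i).-1)
     zstar (nth 0%N s i - a) (rcons (behead (rot i s)) a.+1)
  = (1 - t) * \sum_(i < size s) zstar (nth 0%N s i).+1 (behead (rot i s))
    + t ^+ size s * \sum_(i < (size s).+1) ((sumn s)%:R - i%:R) * 'C(size s, i)%:R
        * c ^+ i * zstar (sumn s - i).+1 [::].
Proof.
move=> s0 s1; set l := size s; set k := sumn s.
have l0 : (0 < l)%N by rewrite /l; case: (s) s1.
have lk : (l <= k)%N := size_le_sumn s0.
pose A u := \tr (xdiff^T *m zchain u); pose C u := \tr (xlow^T *m zchain u).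
(* Moving the first entry of [rot i s] to the end gives [rot i.+1 s]. Summed over all i, traces
   ending in k_i can thus be replaced by traces beginning with k_i. *)
have rotS (F : seq nat -> R) :
    \sum_(i < l) F (rcons (behead (rot i s)) (nth 0%N s i)) = \sum_(i < l) F (rot i s).
  transitivity (\sum_(i < l) F (rot i.+1 s)).
    apply: eq_bigr => i _; congr F.
    by rewrite -[i.+1]add1n rotD ?ltn_ord // rot_cons // rot1_cons.
  rewrite -(big_mkord xpredT (fun i => F (rot i.+1 s))).
  rewrite -(big_mkord xpredT (fun i => F (rot i s))).
  rewrite -(big_add1 _ _ 0%N l.+1 xpredT (fun i => F (rot i s))) big_nat_recr //=.
  by rewrite [RHS]big_ltn // rot_size rot0 addrC.
transitivity (\sum_(i < l) (A (rot i s) - C (rot i s)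
    - \tr (xdiff^T *m (zdiag (nth 0%N s i) *m zchain (behead (rot i s)) *m zstep))
    + t ^+ l * \sum_(p < n) (nth 0%N s i).-1%:R * (y p.+1 * zprod s p))).
  rewrite big_split /= sumrB sumrB -(rotS A) -(rotS C) -!sumrB -big_split /=.
  apply: eq_bigr => i _; rewrite sum_zstar_pair; last by rewrite (allP s0) ?mem_nth.
  rewrite -rot_cons // size_behead size_rot prednK //.
  under [in LHS]eq_bigr do rewrite /zprod (perm_big s) ?perm_rot //=.
  by rewrite /A /C /zprod; ring.
transitivity (\sum_(i < l) ((1 - t) * zstar (nth 0%N s i).+1 (behead (rot i s))
    + t ^+ l * \sum_(p < n) x p.+1 * zprod s p
    + t ^+ l * \sum_(p < n) (nth 0%N s i).-1%:R * (y p.+1 * zprod s p))).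
  apply: eq_bigr => i _; congr (_ + _).
  have := @trace_cyclic (nth 0%N s i) (behead (rot i s)).
  rewrite -rot_cons // has_rot size_behead size_rot prednK // => /(_ _ s1) E.
  rewrite addrAC E; last by rewrite (allP s0) ?mem_nth.
  congr (_ + _ * _); apply: eq_bigr => p _.
  by rewrite /zprod (perm_big s) ?perm_rot.
rewrite big_split /= big_split /= -mulr_sumr -addrA; congr (_ + _).
rewrite -2!mulr_sumr sumr_const card_ord -mulrDr; congr (_ * _).
have zstar1 a : zstar a [::] = \sum_(p < n) zfac a p.
  by apply: eq_bigr => i _; rewrite /zstar /= mulmx1 (bigD1 i) //= zdiag_diag
     big1 ?addr0 // => j; rewrite !mxE eq_sym => /negPf->; rewrite mulr0n.
under [RHS]eq_bigr do rewrite zstar1 mulr_sumr.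
rewrite exchange_big [RHS]exchange_big -sumrMnl -big_split /=; apply: eq_bigr => p _.
rewrite -mulr_suml.
have -> : \sum_(i < l) (nth 0%N s i).-1%:R = (k - l)%:R :> R.
  rewrite -natr_sum; congr _%:R.
  transitivity (\sum_(a <- s) a.-1)%N; first by rewrite (big_nth 0%N) big_mkord.
  rewrite /k /l; elim: (s) s0 => [|a u IH] /=; first by rewrite big_nil.
  move=> /andP[a0 u0]; rewrite big_cons IH //; have := size_le_sumn u0; lia.
rewrite zprodE // -/k -/l.
(* The diagonal terms l x and (k - l) y, times y^l x^(k-l), share a factor y; the cofactor is
   [euler_binomial] with u = x and u + c = y. *)
transitivity (y p.+1 *
  \sum_(i < l.+1) (k%:R - i%:R) * 'C(l, i)%:R * c ^+ i * x p.+1 ^+ (k - i)).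
  rewrite euler_binomial ?l0 // -y_def // -mulr_natl.
  have yE : y p.+1 ^+ l = y p.+1 * y p.+1 ^+ l.-1 by rewrite -exprS prednK.
  by rewrite yE (exprS _ (k - l)); ring.
by rewrite mulr_sumr; apply: eq_bigr => i _; rewrite /zfac /=; ring.
Qed.

(** * From fillings to weakly decreasing chains *)

Fixpoint zstrict s M : R :=
  if s is k :: r then \sum_(m < M) zfac k m * zstrict r m else 1.

Definition zboxes k r M : R :=
  \sum_(cs <- boxes (size r))
    c ^+ (k + sumn r - sumn (fill k r cs)) * t ^+ ((size r).+1 - size (fill k r cs))
      * zstrict (fill k r cs) M.

(** The continuation of a chain after the index m: the next index equals m, with weight t, or is
    smaller. *)
Fixpoint zweak r m : R :=
  if r is k :: r' then t * (zfac k m * zweak r' m) + \sum_(p < m) zfac k p * zweak r' p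
  else 1.

(** Induction on the first box: a comma makes the next index strictly smaller, while [Plus] and
    [MinusOnePlus] together give, by [zfacM], two equal indices with weight t. *)
Lemma zboxesE k r M : (0 < k)%N -> all (fun a => 0 < a)%N r ->
  zboxes k r M = \sum_(m < M) zfac k m * zweak r m.
Proof.
elim: r k M => [|b r IH] k M k0 /=.
  by move=> _; rewrite /zboxes big_seq1 /= addn0 !subnn !expr0 !mul1r.
move=> /andP[b0 r0]; rewrite /zboxes /= big_flatten big_map /=.
transitivity (\sum_(m < M) zfac k m * zboxes b r m
   + t * (zboxes (k + b) r M + c * zboxes (k + b - 1) r M)).
  rewrite mulrDr addrA.
  under [X in _ = X + _ + _]eq_bigr do rewrite /zboxes mulr_sumr.
  rewrite exchange_big /zboxes !mulr_sumr -!big_split /=; apply: eq_bigr => cs _.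
  rewrite !big_cons big_nil addr0 /= addrA !subSS !subnDl !addnA.
  rewrite !(subSn (size_fill _ _ _)).
  (* The unit of weight lost at [MinusOnePlus] supplies the extra factor c. *)
  have -> : (k + b + sumn r - sumn (fill (k + b - 1) r cs)
    = (k + b - 1 + sumn r - sumn (fill (k + b - 1) r cs)).+1)%N.
    by have := sumn_fill (k + b - 1) r cs; lia.
  congr (_ + _ + _); last by rewrite !exprS; ring.
    by rewrite mulr_sumr; apply: eq_bigr => m _; ring.
  by rewrite exprS; ring.
rewrite !IH //; try by lia.
rewrite mulr_sumr -big_split mulr_sumr -big_split /=.
apply: eq_bigr => m _; rewrite IH // mulrA -mulrDl zfacM //; ring.
Qed.

Lemma zweakE r (i : 'I_n) : zweak r i = \sum_j zchain r i j.
Proof.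
elim: r i => [|k r IH] i /=.
  rewrite (bigD1 i) //= big1 ?addr0 ?mxE ?eqxx // => j.
  by rewrite mxE eq_sym => /negPf->.
under [RHS]eq_bigr do rewrite -mulmxA mxE.
rewrite [RHS]exchange_big /=.
transitivity (\sum_p zstep i p * (zfac k p * zweak r p)).
  by rewrite (sum_zstep_row (fun p => zfac k p * zweak r p)) big_mkord.
apply: eq_bigr => p _; rewrite -mulr_sumr IH; congr (_ * _).
by rewrite mulr_sumr; apply: eq_bigr => j _; rewrite zdiag_mulE.
Qed.

(** As k >= 2, the factor of the first index vanishes for m_1 > N, so the cut at n can be lowered to
    N. *)
Lemma zstar_boxes k r : (1 < k)%N -> all (fun a => 0 < a)%N r ->
  zstar k r = zboxes k r N.
Proof.
move=> k1 r0; rewrite zboxesE 1?ltnW //.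
transitivity (\sum_(m < n) zfac k m * zweak r m).
  apply: eq_bigr => i _; rewrite zweakE mulr_sumr.
  by apply: eq_bigr => j _; rewrite zdiag_mulE.
have Nn : (N <= n)%N by apply: leq_trans le2Nn; apply: leq_addr.
rewrite -!(big_mkord xpredT (fun m => zfac k m * zweak r m)).
rewrite (big_cat_nat (leq0n N) Nn) /=.
rewrite -[RHS]addr0; congr (_ + _); rewrite big_nat big1 // => m /andP[Nm _].
by rewrite zfac_eq0 // mul0r.
Qed.

End CyclicSum.

(** * Power series truncated after q^N *)

Local Notation truncated N := {poly %/ ('X^(N.+1) : {poly rat})}.

Section Truncation.
Variable N : nat.
Local Notation trunc := (truncated N).
Implicit Types f g : fps.

(** Q[q]/(q^(N+1)) is a commutative ring that keeps the coefficients up to q^N and in which q^m/[m]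
    vanishes for m > N. *)
Definition ftrunc f : trunc := in_qpoly 'X^(N.+1) (\poly_(i < N.+1) f i).

Lemma coef_in_qpolyXn (p : {poly rat}) i :
  (in_qpoly 'X^(N.+1) p : {poly rat})`_i = if (i < N.+1)%N then p`_i else 0.
Proof.
by rewrite /= mk_monic_Xn /= -Pdiv.RingMonic.take_poly_rmodp coef_take_poly.
Qed.

Lemma coef_ftrunc f i : (ftrunc f)`_i = if (i < N.+1)%N then f i else 0.
Proof. by rewrite coef_in_qpolyXn coef_poly; case: (i < N.+1)%N. Qed.

Lemma coef_trunc_mul (u v : trunc) i : (i < N.+1)%N ->
  (u * v)`_i = \sum_(j < i.+1) u`_j * v`_(i - j).
Proof. by move=> iN; rewrite coef_in_qpolyXn iN coefM. Qed.

Lemma trunc_eq (u v : trunc) : (forall i, (i < N.+1)%N -> u`_i = v`_i) -> u = v.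
Proof.
move=> uv; apply/val_inj/polyP => i; have [iN|Ni] := ltnP i N.+1; first exact: uv.
have sz (w : trunc) : (size (w : {poly rat}) <= i)%N.
  by apply: leq_trans (size_npoly w) _; rewrite mk_monic_Xn size_polyXn.
by rewrite !nth_default ?sz.
Qed.

Lemma eq_ftrunc f g : (forall i, (i <= N)%N -> f i = g i) -> ftrunc f = ftrunc g.
Proof. by move=> fg; apply: trunc_eq => i iN; rewrite !coef_ftrunc iN fg. Qed.

Lemma ftrunc1 : ftrunc fps1 = 1.
Proof.
apply: trunc_eq => i iN; rewrite coef_ftrunc iN.
by rewrite [RHS]coefC.
Qed.

Lemma ftrunc_mul f g : ftrunc (fps_mul f g) = ftrunc f * ftrunc g.
Proof.
apply: trunc_eq => i iN; rewrite coef_trunc_mul // coef_ftrunc iN.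
apply: eq_bigr => j _; rewrite !coef_ftrunc (leq_ltn_trans (leq_subr _ _) iN).
by rewrite (leq_trans (ltn_ord j) iN).
Qed.

Lemma ftrunc_exp f k : ftrunc (fps_exp f k) = ftrunc f ^+ k.
Proof.
by elim: k => [|k IH]; [exact: ftrunc1 | rewrite [RHS]exprS -IH -ftrunc_mul].
Qed.

Lemma ftrunc_sub f g : ftrunc (fps_sub f g) = ftrunc f - ftrunc g.
Proof.
by apply: trunc_eq => i iN; rewrite coef_ftrunc iN coefB !coef_ftrunc iN.
Qed.

Lemma ftrunc_sum (I : Type) (r : seq I) (F : I -> fps) :
  ftrunc (fun i => \sum_(a <- r) F a i) = \sum_(a <- r) ftrunc (F a).
Proof.
apply: trunc_eq => i iN; rewrite coef_ftrunc iN coefn_sum.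
by apply: eq_bigr => a _; rewrite coef_ftrunc iN.
Qed.

Lemma size_fps_inv_seq f m : size (fps_inv_seq f m) = m.+1.
Proof. by elim: m => //= m IH; rewrite size_rcons IH. Qed.

Lemma fps_inv_seqE f n i : (i <= n)%N -> nth 0 (fps_inv_seq f n) i = fps_inv f i.
Proof.
elim: n => [|n IH]; first by rewrite leqn0 => /eqP->.
rewrite leq_eqVlt => /predU1P[->//|lein] /=.
by rewrite nth_rcons size_fps_inv_seq lein IH.
Qed.

Lemma fps_mulV f : f 0%N != 0 -> fps_mul f (fps_inv f) =1 fps1.
Proof.
move=> f0 [|n]; first by rewrite /fps_mul big_ord1 /= divff.
have -> : fps1 n.+1 = 0 by [].
rewrite /fps_mul big_ord_recl subn0 {1}/fps_inv /= nth_rcons size_fps_inv_seq ltnn eqxx.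
rewrite mulNr mulrN mulVKf // big_add1 big_mkord /= addrC; apply/eqP.
rewrite subr_eq0; apply/eqP/eq_bigr => i _.
by rewrite fps_inv_seqE // leq_subLR; lia.
Qed.

Lemma ftrunc_inv f : f 0%N != 0 -> ftrunc f * ftrunc (fps_inv f) = 1.
Proof.
by move=> f0; rewrite -ftrunc_mul -ftrunc1; apply: eq_ftrunc => i _; apply: fps_mulV.
Qed.

Lemma fps_mul_coef0 f g : fps_mul f g 0%N = f 0%N * g 0%N.
Proof. by rewrite /fps_mul big_ord1. Qed.

Lemma fps_exp_coef0 f k : fps_exp f k 0%N = f 0%N ^+ k.
Proof. by elim: k => // k IH; rewrite exprS -IH -fps_mul_coef0. Qed.

Lemma qint_coef0 m : (0 < m)%N -> qint m 0%N = 1.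
Proof.
case: m => // m _; rewrite /qint fps_mul_coef0 /fps_sub /fps_add /fps_opp.
by rewrite fps_exp_coef0 /fps_inv /= expr0n /fpsX /fps1 /fpsC /= /fps_add /=.
Qed.

Lemma fps_expX e i : fps_exp fpsX e i = (i == e)%:R.
Proof.
elim: e i => [|e IH] [|i] //=; first by rewrite fps_mul_coef0 mul0r.
rewrite /fps_mul !big_ord_recl big1 ?addr0 => [|j _]; last by rewrite mul0r.
by rewrite mul0r add0r mul1r subSS subn0 IH.
Qed.

(** [zterm k m] is divisible by q^((k-1)m), and (k-1)m >= m > i. *)
Lemma zterm_mul_eq0 k m g i : (1 < k)%N -> (i < m)%N -> fps_mul (zterm k m) g i = 0.
Proof.
move=> k1 im; rewrite /fps_mul big1 // => j _.
rewrite /zterm {1}/fps_mul big1 ?mul0r // => p _.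
rewrite fps_expX ltn_eqF ?mul0r //.
apply: (@leq_trans m); last by rewrite leq_pmull ?subn_gt0.
by apply: leq_ltn_trans im; have := ltn_ord p; have := ltn_ord j; lia.
Qed.

(** [zeta_q] reads coefficient i from the sum cut at m_1 <= i; the further terms up to N start
    beyond q^i. *)
Lemma ftrunc_zeta_q k s : (1 < k)%N ->
  ftrunc (zeta_q (k :: s)) = ftrunc (zsum (k :: s) N).
Proof.
move=> k1; apply: eq_ftrunc => i iN; rewrite /zeta_q /=.
rewrite (@big_cat_nat _ _ _ i.+1 1 N.+1) //= -[LHS]addr0; congr (_ + _).
by rewrite big_nat big1 // => m /andP[im _]; rewrite zterm_mul_eq0.
Qed.

(** * The sequences q^m/[m] and 1/[m] *)

Definition tq : trunc := ftrunc fpsX.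
Definition ty m : trunc := ftrunc (fps_inv (qint m)).
Definition tx m : trunc := tq ^+ m * ty m.

Lemma ftrunc_1X : ftrunc (fps_sub fps1 fpsX) = 1 - tq.
Proof. by rewrite ftrunc_sub ftrunc1. Qed.

Lemma ftrunc_qintM m : (1 - tq) * ftrunc (qint m) = 1 - tq ^+ m.
Proof.
rewrite /qint ftrunc_mul ftrunc_sub ftrunc_exp ftrunc1 mulrCA -ftrunc_1X.
by rewrite ftrunc_inv ?mulr1.
Qed.

Lemma ftrunc_qint_ty m : (0 < m)%N -> ftrunc (qint m) * ty m = 1.
Proof. by move=> m0; rewrite ftrunc_inv // qint_coef0 ?oner_eq0. Qed.

Lemma ty_def m : (0 < m)%N -> ty m = tx m + (1 - tq).
Proof.
move=> m0; have : (1 - tq) * (ftrunc (qint m) * ty m) = (1 - tq ^+ m) * ty m.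
  by rewrite mulrA ftrunc_qintM.
by rewrite ftrunc_qint_ty // mulr1 => ->; rewrite /tx; ring.
Qed.

Lemma ftrunc_qintD d m :
  ftrunc (qint (m + d)) - ftrunc (qint m) = tq ^+ m * ftrunc (qint d).
Proof.
have v1 : (1 - tq) * ftrunc (fps_inv (fps_sub fps1 fpsX)) = 1.
  by rewrite -ftrunc_1X ftrunc_inv.
rewrite /qint !ftrunc_mul !ftrunc_sub !ftrunc_exp ftrunc1 -/tq exprD; ring.
Qed.

(** Here x_m - x_(m+d) = y_m - y_(m+d) = y_m y_(m+d) ([m+d] - [m]) with [m+d] - [m] = q^m [d], and
    [d] cancels against x_d = q^d/[d]. *)
Lemma tx_rel d m : (0 < d)%N -> (0 < m)%N ->
  tx d * (tx m - tx (m + d)%N) = tx (m + d)%N * ty m.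
Proof.
move=> d0 m0; have md0 : (0 < m + d)%N by rewrite addn_gt0 m0.
have yd := ftrunc_qint_ty d0; have ym := ftrunc_qint_ty m0.
have ymd := ftrunc_qint_ty md0.
have -> : tx m - tx (m + d) = ty m - ty (m + d) by rewrite !ty_def //; ring.
have -> : ty m - ty (m + d) = ty m * ty (m + d) * (tq ^+ m * ftrunc (qint d)).
  transitivity (ty m * (ftrunc (qint (m + d)) * ty (m + d))
     - ftrunc (qint m) * ty m * ty (m + d)); first by rewrite ym ymd mulr1 mul1r.
  by rewrite -ftrunc_qintD; ring.
transitivity (tx (m + d) * ty m * (ftrunc (qint d) * ty d)); last by rewrite yd mulr1.
by rewrite /tx exprD; ring.
Qed.

Lemma tx_eq0 m : (N < m)%N -> tx m = 0.
Proof.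
move=> Nm; suff tqm : tq ^+ m = 0 by rewrite /tx tqm mul0r.
rewrite -ftrunc_exp; apply: trunc_eq => i iN.
by rewrite coef_ftrunc iN fps_expX ltn_eqF ?coef0 // (leq_trans iN).
Qed.

Lemma ftrunc_zterm k m : (0 < k)%N -> (0 < m)%N ->
  ftrunc (zterm k m) = ty m * tx m ^+ k.-1.
Proof.
case: k => // k _ m0; rewrite /zterm ftrunc_mul ftrunc_exp -/tq subn1 /=.
have fk : fps_exp (qint m) k.+1 0%N != 0.
  by rewrite fps_exp_coef0 qint_coef0 // expr1n oner_eq0.
have <- : ty m ^+ k.+1 = ftrunc (fps_inv (fps_exp (qint m) k.+1)).
  rewrite -[LHS]mulr1 -(ftrunc_inv fk) ftrunc_exp mulrA -exprMn (mulrC (ty m)).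
  by rewrite ftrunc_qint_ty // expr1n mul1r.
by rewrite /tx exprMn mulnC exprM (exprS (ty m)); ring.
Qed.

End Truncation.

(** * Specialization to polynomials in t *)

Section Specialization.
Variable N : nat.
Local Notation trunc := (truncated N).

(** The indeterminate ['X] plays the role of t, so x, y and c become constant polynomials. *)
Definition px m : {poly trunc} := (tx N m)%:P.
Definition py m : {poly trunc} := (ty N m)%:P.
Definition pc : {poly trunc} := (1 - tq N)%:P.

Lemma py_def m : (0 < m)%N -> py m = px m + pc.
Proof. by move=> m0; rewrite /py ty_def // polyCD. Qed.

Lemma px_rel d m : (0 < d)%N -> (0 < m)%N ->
  px d * (px m - px (m + d)%N) = px (m + d)%N * py m.
Proof. by move=> d0 m0; rewrite -polyCB -!polyCM tx_rel. Qed.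

Lemma px_eq0 m : (N < m)%N -> px m = 0.
Proof. by move=> Nm; rewrite /px tx_eq0. Qed.

Lemma zfac_zterm k m : (0 < k)%N -> zfac px py k m = (ftrunc N (zterm k m.+1))%:P.
Proof. by move=> k0; rewrite ftrunc_zterm // polyCM polyC_exp. Qed.

Lemma zstrict_zsum s M : all (fun k => 0 < k)%N s ->
  zstrict px py s M = (ftrunc N (zsum s M))%:P.
Proof.
elim: s M => [|k s IH] M /=; first by rewrite ftrunc1.
move=> /andP[k0 s0]; rewrite ftrunc_sum big_add1 big_mkord rmorph_sum /=.
by apply: eq_bigr => m _; rewrite ftrunc_mul polyCM -zfac_zterm // IH.
Qed.

Lemma zstar_coef k r m : (1 < k)%N -> all (fun a => 0 < a)%N r ->
  (zstar 'X px py (N + N) k r)`_m = ftrunc N (zeta_qt (k :: r) m).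
Proof.
move=> k1 r0.
rewrite (zstar_boxes 'X py_def px_eq0 (leqnn _)) // coef_sum /= ftrunc_sum.
apply: eq_bigr => cs _.
have [a a1 [s def_s]] := fill_head cs k1 r0.
rewrite zstrict_zsum ?fill_gt0 ?(ltnW k1) // def_s -ftrunc_zeta_q // -polyC_exp.
(* The coefficient of t^m keeps exactly the fillings with l - dep = m, as in [zeta_qt]. *)
rewrite coefMC coefCM coefXn /= eq_sym.
case: eqP => _; last first.
  by rewrite mulr0 mul0r; apply: trunc_eq => i iN; rewrite coef_ftrunc iN coef0.
by rewrite mulr1 -ftrunc_1X -ftrunc_exp -ftrunc_mul.
Qed.

Lemma zeta_qt_coef k r m : (1 < k)%N -> all (fun a => 0 < a)%N r ->
  zeta_qt (k :: r) m N = ((zstar 'X px py (N + N) k r)`_m : trunc)`_N.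
Proof. by move=> k1 r0; rewrite zstar_coef // coef_ftrunc ltnSn. Qed.

End Specialization.

(** * Comparison of the coefficients of t^m q^N *)

Theorem theorem1p3 (ks : seq nat) :
  all (fun k => 0 < k)%N ks -> ks != nseq (size ks) 1%N ->
  let l := size ks in
  let k := sumn ks in
  forall m N : nat,
    \sum_(i < l) \sum_(j < (nth 0%N ks i).-1)
        zeta_qt ((nth 0%N ks i - j)%N :: rcons (behead (rot i ks)) j.+1) m N
    =
    (let A := fun m' : nat =>
        \sum_(i < l) zeta_qt ((nth 0%N ks i).+1 :: behead (rot i ks)) m' N in
     A m - (if m is m'.+1 then A m' else 0))
    + (if (l <= m)%N then
         \sum_(i < l.+1) (k%:R - i%:R) * 'C(l, i)%:R *
            fps_mul (fps_exp (fps_sub fps1 fpsX) i) (zeta_qt [:: (k - i).+1] (m - l)%N) N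
       else 0).
Proof.
move=> ks0 ks1 l k m N.
have has1 : has (fun k => 1 < k)%N ks.
  apply: contraNT ks1; rewrite -all_predC => no2; apply/eqP/all_pred1P.
  apply/allP => a ain; have := allP ks0 a ain.
  by have := allP no2 a ain; rewrite /=; lia.
(* Strictness comes from an entry >= 2 and gives k - i + 1 >= 2 for all i <= l, as the single zeta
   values require. *)
have lk : (l < k)%N.
  rewrite /l /k; elim: (ks) ks0 has1 => //= a s IH /andP[a0 s0].
  case/orP=> [a1|/(IH s0)]; last by lia.
  by have := size_le_sumn s0; lia.
have beh0 i : all (fun a => 0 < a)%N (behead (rot i ks)).
  by apply/allP => a /mem_behead; rewrite mem_rot => /(allP ks0).
pose co p := ((p : {poly truncated N})`_m : truncated N)`_N.
have := zstar_cyclic 'X (@py_def N) (@px_rel N) (@px_eq0 N) (leqnn _) ks0 has1.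
(* In the coefficient of t^m the factor 1 - t becomes a difference of the values at m and m - 1, and
   t^l shifts m by l, giving 0 for m < l. *)
move=> /(congr1 co); rewrite /co {co} coefD mulrBl mul1r coefB coefXM coefXnM -/l -/k.
set S := \sum_(i < l) zstar _ _ _ _ _ _.
have Scoef m' : (S`_m' : truncated N)`_N
    = \sum_(i < l) zeta_qt ((nth 0%N ks i).+1 :: behead (rot i ks)) m' N.
  rewrite coef_sum coefn_sum; apply: eq_bigr => i _.
  by rewrite zeta_qt_coef // ltnS (allP ks0) // mem_nth.
move=> E; transitivity ((\sum_(i < l) \sum_(a < (nth 0%N ks i).-1)
   zstar 'X (@px N) (@py N) (N + N) (nth 0%N ks i - a)
     (rcons (behead (rot i ks)) a.+1))`_m`_N).
  rewrite coef_sum coefn_sum; apply: eq_bigr => i _.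
  rewrite coef_sum coefn_sum; apply: eq_bigr => a _.
  rewrite zeta_qt_coef //; first by have := ltn_ord a; lia.
  by rewrite all_rcons beh0.
rewrite E coefD coefB; congr (_ - _ + _).
- by rewrite Scoef.
- by case: (m) => [|m'] /=; rewrite ?coef0 // Scoef.
rewrite ltnNge; case: leqP => lm /=; last by rewrite coef0.
rewrite coef_sum coefn_sum; apply: eq_bigr => i _.
have il : (i <= l)%N by rewrite -ltnS.
have ik : (i <= k)%N by apply: leq_trans il (ltnW lk).
rewrite -natrB // -!natrM -mulrA !mulr_natl coefMn.
rewrite -polyC_exp coefCM zstar_coef //; last by lia.
rewrite -ftrunc_1X -ftrunc_exp -ftrunc_mul raddfMn /= coefMn coef_ftrunc ltnSn.
by rewrite -natrB // -natrM mulr_natl.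
Qed.
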